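(* Let $\mathbb{O} = (n, \mathbb{O}^+, \mathbb{O}^-)$ be a covering orientation, that is, $\mathbb{O}^+, \mathbb{O}^- \subseteq [n]$ and $\{2, \dots, n-1\} \subseteq \mathbb{O}^+ \cup \mathbb{O}^-$. Then the sets $\mathsf{IPIP}(\mathbb{O})$, $\mathsf{DPIP}(\mathbb{O})$ and $\mathsf{PIP}(\mathbb{O})$ all induce sublattices of the weak order lattice $(\mathcal{P}(n), \preccurlyeq, \wedge_{\mathcal{T}}, \vee_{\mathcal{T}})$ on posets on $[n]$.
   Context: Weak order on posets. $[n] = \{1,\dots,n\}$; $\mathcal{P}(n)$ is the set of (reflexive) posets on $[n]$. For a reflexive relation $R \subseteq [n]^2$ let $R^{\mathsf{Inc}} = \{(a,b)\in R : a\le b\}$, $R^{\mathsf{Dec}} = \{(b,a)\in R : a\le b\}$, and let $R^{\mathsf{tc}}$ be its transitive closure. Put $R \preccurlyeq S$ iff $R^{\mathsf{Inc}} \supseteq S^{\mathsf{Inc}}$ and $R^{\mathsf{Dec}} \subseteq S^{\mathsf{Dec}}$. Write $u \mathrel{R} v$ for $(u,v)\in R$. Define $R^{\mathsf{tdd}} = R \smallsetminus \{(b,a) \in R^{\mathsf{Dec}} : \exists\, i \le b,\ j \ge a \text{ with } i \mathrel{R} b \mathrel{R} a \mathrel{R} j \text{ and not } i \mathrel{R} j\}$ and $R^{\mathsf{tid}} = R \smallsetminus \{(a,b) \in R^{\mathsf{Inc}} : \exists\, i \ge a,\ j \le b \text{ with } i \mathrel{R} a \mathrel{R} b \mathrel{R}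 j \text{ and not } i \mathrel{R} j\}$. The weak order on $\mathcal{P}(n)$ is a lattice with meet $R \wedge_{\mathcal{T}} S = \big((R^{\mathsf{Inc}} \cup S^{\mathsf{Inc}})^{\mathsf{tc}} \cup (R^{\mathsf{Dec}} \cap S^{\mathsf{Dec}})\big)^{\mathsf{tdd}}$ and join $R \vee_{\mathcal{T}} S = \big((R^{\mathsf{Inc}} \cap S^{\mathsf{Inc}}) \cup (R^{\mathsf{Dec}} \cup S^{\mathsf{Dec}})^{\mathsf{tc}}\big)^{\mathsf{tid}}$. A subset induces a sublattice if it is closed under this meet and join. Permutations. A permutation $\sigma \in \mathfrak{S}(n)$ gives the total order $\vartriangleleft_\sigma$ with $u \vartriangleleft_\sigma v$ iff $\sigma^{-1}(u) \le \sigma^{-1}(v)$. The weak order on $\mathfrak{S}(n)$ is: $\sigma \preccurlyeq \tau$ iff every pair $a<b$ with $\sigma^{-1}(a)>\sigma^{-1}(b)$ also satisfies $\tau^{-1}(a)>\tau^{-1}(b)$. A linear extension of a poset $\vartriangleleft$ is a permutation $\sigma$ with ${\vartriangleleft} \subseteq {\vartriangleleft_\sigma}$. A ''weak order maximal (minimal) linear extension'' means a linear extension that is the greatest (least) one in the weak order among all linear extensions. Orientations and permutrees. An orientation $\mathbb{O} = (n, \mathbb{O}^+, \mathbb{O}^-)$ consists of arbitrary subsets $\mathbb{O}^+, \mathbb{O}^- \subseteq [n]$. An $\mathbb{O}$-permutree is a directed tree $T$ with nodes bijectively labeled by (and identified with) $[n]$ such that each node $v$ has two parent slots (left and right) if $v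 \in \mathbb{O}^+$ and one parent slot otherwise, and two child slots (left and right) if $v \in \mathbb{O}^-$ and one child slot otherwise; each slot is either empty or contains exactly one neighbor (parents are outgoing neighbors, children are incoming neighbors); and if $v$ has two parent (resp. child) slots, all labels in the left ancestor (resp. descendant) subtree of $v$ (the connected component of $T \smallsetminus v$ attached through the left slot) are smaller than $v$ and all labels in the right one are larger than $v$. Let $i \vartriangleleft_T j$ iff there is a directed path (possibly of length $0$) from $i$ to $j$ in $T$. The permutree lattice order is: $T \preccurlyeq T'$ iff there are linear extensions $\sigma$ of $\vartriangleleft_T$ and $\sigma'$ of $\vartriangleleft_{T'}$ with $\sigma \preccurlyeq \sigma'$. Families. $\mathsf{PIP}(\mathbb{O}) = \{ {\vartriangleleft_T} \cap {\vartriangleleft_{T'}} : T \preccurlyeq T' \ \mathbb{O}\text{-permutrees}\}$. $\mathsf{IPIP}(\mathbb{O})$ is the set of posets in $\mathcal{P}(n)$ that admit a weak order maximal linear extension in which there are no $a<b<c$ such that $b \in \mathbb{O}^+$ and the values $b,a,c$ appear in this order from left to right, and no $a<b<c$ such that $b \in \mathbb{O}^-$ and $a,c,b$ appear in this order. $\mathsf{DPIP}(\mathbb{O})$ is the set of posets in $\mathcal{P}(n)$ that admit a weak order minimal linear extension in which there are no $a<b<c$ such that $b \in \mathbb{O}^+$ and $b,c,a$ appear in this order, and no $a<b<c$ such that $b \in \mathbb{O}^-$ and $c,a,b$ appear in this order. *)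

(* Defs.v *)
From mathcomp Require Import all_boot all_fingroup.

Set Implicit Arguments.
Unset Strict Implicit.
Unset Printing Implicit Defensive.

(* [n] is represented by 'I_n, so the label k of [n] is the ordinal k - 1.    *)
(* A pair (u, v) belongs to R when u R v.                                     *)
Definition brel (n : nat) := {set 'I_n * 'I_n}.

Section WeakOrderOnPosets.
Variable n : nat.
Implicit Types R S : brel n.

Definition is_poset R : Prop :=
  [/\ forall u, (u, u) \in R,
      forall u v, (u, v) \in R -> (v, u) \in R -> u = v
    & forall u v w, (u, v) \in R -> (v, w) \in R -> (u, w) \in R].

Definition Inc R : brel n := [set p in R | p.1 <= p.2].
Definition Dec R : brel n := [set p in R | p.2 <= p.1].

Definition weak_le R S : Prop := Inc S \subset Inc R /\ Dec R \subset Dec S.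

(* [connect] is the reflexive transitive closure; the first step is forced so *)
(* that this is the plain transitive closure.                                 *)
Definition tc R : brel n :=
  [set p : 'I_n * 'I_n |
    [exists w, ((p.1, w) \in R) && connect (fun x y => (x, y) \in R) w p.2]].

Definition tdd R : brel n :=
  R :\: [set p in Dec R | let: (b, a) := p in
          [exists i : 'I_n, exists j : 'I_n,
            [&& i <= b, a <= j, (i, b) \in R, (b, a) \in R, (a, j) \in R
              & (i, j) \notin R]]].

Definition tid R : brel n :=
  R :\: [set p in Inc R | let: (a, b) := p in
          [exists i : 'I_n, exists j : 'I_n,
            [&& a <= i, j <= b, (i, a) \in R, (a, b) \in R, (b, j) \in R
              & (i, j) \notin R]]].

Definition meetT R S : brel n :=
  tdd (tc (Inc R :|: Inc S) :|: (Dec R :&: Dec S)).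
Definition joinT R S : brel n :=
  tid ((Inc R :&: Inc S) :|: tc (Dec R :|: Dec S)).

(* The lattice is the set of posets ordered by [weak_le], with operations     *)
(* [meetT] and [joinT]; a sublattice is a subset closed under both.           *)
Definition induces_sublattice (F : brel n -> Prop) : Prop :=
  (forall R, F R -> is_poset R) /\
  (forall R S, F R -> F S -> F (meetT R S) /\ F (joinT R S)).

End WeakOrderOnPosets.

Section Permutations.
Variable n : nat.
Implicit Types s t : 'S_n.

(* s maps positions to values. *)
Definition pos s (u : 'I_n) : 'I_n := (s^-1)%g u.

Definition total_of s : brel n := [set p : 'I_n * 'I_n | pos s p.1 <= pos s p.2].

Definition perm_le s t : Prop :=
  forall a b : 'I_n, a < b -> pos s b < pos s a -> pos t b < pos t a.

Definition linear_extension (R : brel n) s : Prop := R \subset total_of s.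

Definition max_linear_extension (R : brel n) s : Prop :=
  linear_extension R s /\ (forall t, linear_extension R t -> perm_le t s).

Definition min_linear_extension (R : brel n) s : Prop :=
  linear_extension R s /\ (forall t, linear_extension R t -> perm_le s t).

Definition appear s (x y z : 'I_n) : Prop := pos s x < pos s y < pos s z.

End Permutations.

Record orientation (n : nat) := Orientation {
  Oplus : {set 'I_n};
  Ominus : {set 'I_n}
}.

(* {2, ..., n - 1} corresponds to the ordinals i with 0 < i < n - 1.          *)
Definition covering n (o : orientation n) : Prop :=
  forall i : 'I_n, 0 < i -> i.+1 < n -> i \in Oplus o :|: Ominus o.

(* [Mid] is the only slot of a node that does not have two of them.           *)
Variant slot := Left | Mid | Right.

Definition has_slot (two : bool) (s : slot) : bool :=
  if s is Mid then ~~ two else two.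

Record slotted_graph (n : nat) := SlottedGraph {
  parent : 'I_n -> slot -> option 'I_n;
  child : 'I_n -> slot -> option 'I_n
}.

Section Permutrees.
Variable n : nat.
Implicit Types (T : slotted_graph n) (o : orientation n) (u v w : 'I_n).

Definition edge T : rel 'I_n :=
  fun u v => has (fun s : slot => parent T u s == Some v) [:: Left; Mid; Right].

Definition adj T : rel 'I_n := fun u v => edge T u v || edge T v u.

Definition is_directed_tree T : Prop :=
  [/\ forall u v, edge T u v -> ~~ edge T v u,
      forall u v, connect (adj T) u v
    & forall c : seq 'I_n, ucycle (adj T) c -> size c < 3].

(* For a neighbor w of v: u lies in the component of T minus v containing w.  *)
Definition in_subtree T v w u : bool :=
  connect (fun x y => [&& adj T x y, x != v & y != v]) w u.

Definition is_permutree o T : Prop :=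
  [/\ is_directed_tree T,
      forall u v, (exists s, parent T u s = Some v)
                  <-> (exists s, child T v s = Some u),
      forall v s t w,
        (parent T v s = Some w -> parent T v t = Some w -> s = t) /\
        (child T v s = Some w -> child T v t = Some w -> s = t),
      forall v s,
        (~~ has_slot (v \in Oplus o) s -> parent T v s = None) /\
        (~~ has_slot (v \in Ominus o) s -> child T v s = None)
    & forall v w u, in_subtree T v w u ->
        [/\ v \in Oplus o -> parent T v Left = Some w -> u < v,
            v \in Oplus o -> parent T v Right = Some w -> v < u,
            v \in Ominus o -> child T v Left = Some w -> u < v
          & v \in Ominus o -> child T v Right = Some w -> v < u]].

Definition tree_rel T : brel n :=
  [set p : 'I_n * 'I_n | connect (edge T) p.1 p.2].

Definition permutree_le T T' : Prop :=
  exists s s' : 'S_n,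
    [/\ linear_extension (tree_rel T) s, linear_extension (tree_rel T') s'
      & perm_le s s'].

Definition PIP o (R : brel n) : Prop :=
  exists T T', [/\ is_permutree o T, is_permutree o T', permutree_le T T'
                 & R = tree_rel T :&: tree_rel T'].

Definition IPIP o (R : brel n) : Prop :=
  is_poset R /\
  exists s, max_linear_extension R s /\
    forall a b c : 'I_n, a < b -> b < c ->
      (b \in Oplus o -> ~ appear s b a c) /\
      (b \in Ominus o -> ~ appear s a c b).

Definition DPIP o (R : brel n) : Prop :=
  is_poset R /\
  exists s, min_linear_extension R s /\
    forall a b c : 'I_n, a < b -> b < c ->
      (b \in Oplus o -> ~ appear s b c a) /\
      (b \in Ominus o -> ~ appear s c a b).

End Permutrees.

(* Main.v *)
Require Import Defs.
From mathcomp Require Import all_boot all_fingroup.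
From mathcomp Require Import zify.

Set Implicit Arguments.
Unset Strict Implicit.
Unset Printing Implicit Defensive.

(* The weak order maximal linear extension of R, when it exists, has the same *)
(* increasing relations as R. For a covering orientation, IPIP is therefore   *)
(* the set of posets such that, for a < b < c and a R c, one has a R b if b   *)
(* is a plus node and b R c if b is a minus node; DPIP is described dually.   *)
(* These local conditions survive meets and joins. Finally, PIP is the        *)
(* intersection of IPIP and DPIP: the relation of a permutree satisfies both  *)
(* conditions, and conversely a poset R with both properties has              *)
(* R <= T_s <= s for each linear extension s, where T_s is the permutree of   *)
(* s, and R is the intersection of its minimal and maximal linear extensions. *)

(** * Meets and joins *)

(** Pattern avoidance by an extremal linear extension is traded for closure conditions on the poset
    itself: [IPIP_inc_poset] and [DPIP_dec_poset] identify the two families with [inc_poset] and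
    [dec_poset]. The increasing pairs of a meet are chains of increasing pairs of R and S, and such
    a chain from a to c either visits an intermediate b or jumps over it in one step, to which the
    condition on R or S applies ([meetT_inc_closed]). For the join, covering makes the relation
    transitive before [tid] acts ([prejoin_trans]), so its increasing pairs are the common ones.
    Converses exchange meet and join, which settles the decreasing case ([dec_poset_sublattice]).

    For PIP the key is [PIP_iff]. In one direction, a node with two parents or two children
    separates smaller labels from larger ones, which forces the closure conditions ([tree_rel_plus],
    [tree_rel_minus]). In the other, each permutation yields a permutree ([permutree_of_permutree]),
    and R is contained in the trees of its minimal and maximal linear extensions
    ([sub_tree_rel_permutree_of]). These trees share no other pair, because the two extensions
    already determine the decreasing and the increasing pairs of R. *)

Section Connect.
Variables (T : finType) (e : rel T).

Lemma connect_ind_left (P : T -> Prop) (y : T) :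
  P y -> (forall x w, e x w -> connect e w y -> P w -> P x) ->
  forall x, connect e x y -> P x.
Proof.
move=> Py IH x /connectP [p]; elim: p x => [|w p IHp] x /=; first by move=> _ <-.
case/andP=> exw pw ly; apply: IH exw _ (IHp _ pw ly).
by apply/connectP; exists p.
Qed.

Lemma connect_ind_right (P : T -> Prop) (x : T) :
  P x -> (forall w y, connect e x w -> e w y -> P w -> P y) ->
  forall y, connect e x y -> P y.
Proof.
move=> Px IH y /connectP [p]; elim/last_ind: p y => [|p w IHp] y /=.
  by move=> _ ->.
rewrite rcons_path last_rcons => /andP [pp lw] ->.
by apply: IH lw (IHp _ pp erefl); apply/connectP; exists p.
Qed.

End Connect.

Section Conditions.
Variable n : nat.
Implicit Types (R S : brel n) (o : orientation n).

Definition inc_closed o R := forall a b c : 'I_n, a < b -> b < c ->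
  (a, c) \in R -> (b \in Oplus o -> (a, b) \in R) /\ (b \in Ominus o -> (b, c) \in R).

Definition dec_closed o R := forall a b c : 'I_n, a < b -> b < c ->
  (c, a) \in R -> (b \in Oplus o -> (c, b) \in R) /\ (b \in Ominus o -> (b, a) \in R).

Definition converse R : brel n := [set p | (p.2, p.1) \in R].
Definition op_orientation o := Orientation (Ominus o) (Oplus o).

Lemma in_converse R u v : ((u, v) \in converse R) = ((v, u) \in R).
Proof. by rewrite inE. Qed.

Lemma converseK R : converse (converse R) = R.
Proof. by apply/setP=> [[u v]]; rewrite !in_converse. Qed.

Lemma converse_poset R : is_poset R -> is_poset (converse R).
Proof.
case=> r a t; split=> [u|u v|u v w]; rewrite !in_converse //.
  by move=> h1 h2; apply: a.
by move=> h1 h2; apply: t h2 h1.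
Qed.

(** The converse keeps labels and reverses arrows: a pair leaving c becomes one entering c, so plus
    and minus nodes trade places. *)
Lemma dec_closed_converse o R :
  dec_closed o R <-> inc_closed (op_orientation o) (converse R).
Proof.
split=> h a b c ab bc; have := h a b c ab bc; rewrite !in_converse /=.
  by move=> h1 /h1 [].
by move=> h1 /h1 [].
Qed.

Lemma op_covering o : covering o -> covering (op_orientation o).
Proof. by move=> h i i0 i1; have := h i i0 i1; rewrite !inE orbC. Qed.

Lemma coveringP o (a b c : 'I_n) : covering o -> a < b -> b < c ->
  b \in Oplus o \/ b \in Ominus o.
Proof.
move=> h ab bc; have := h b; rewrite inE => h1; apply/orP/h1; first by lia.
by have := ltn_ord c; lia.
Qed.

End Conditions.

Section MeetJoin.
Variable n : nat.
Implicit Types (R S : brel n) (o : orientation n) (u v w i j : 'I_n).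

Definition step_inc R S : rel 'I_n :=
  fun x y => (x <= y) && (((x, y) \in R) || ((x, y) \in S)).
Definition step_dec R S : rel 'I_n :=
  fun x y => (y <= x) && (((x, y) \in R) || ((x, y) \in S)).

Lemma connect_step_inc_le R S u v : connect (step_inc R S) u v -> u <= v.
Proof.
move: u; apply: connect_ind_left => // x w /andP [xw _] _; exact: leq_trans.
Qed.

Lemma connect_step_dec_le R S u v : connect (step_dec R S) u v -> v <= u.
Proof.
move: u; apply: connect_ind_left => // x w /andP [xw _] _ h.
exact: leq_trans h xw.
Qed.

(** Reflexivity of [e] supplies the forced first step of [tc]. *)
Lemma in_tc (X : brel n) (e : rel 'I_n) u v :
  (forall x y, ((x, y) \in X) = e x y) -> (forall x, e x x) ->
  ((u, v) \in tc X) = connect e u v.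
Proof.
move=> eX re; rewrite inE /=; have eXc : connect (fun x y => (x, y) \in X) =2 connect e.
  by apply: eq_connect=> x y; rewrite eX.
apply/existsP/idP => [[w /andP [uw wv]]|uv].
  by rewrite eXc in wv; apply: connect_trans wv; apply: connect1; rewrite -eX.
by exists u; rewrite eXc uv eX re.
Qed.

(** The relation to which [meetT] applies [tdd], with the diagonal counted among the increasing
    pairs. *)
Definition premeet R S u v : bool :=
  if u <= v then connect (step_inc R S) u v else ((u, v) \in R) && ((u, v) \in S).

Lemma in_premeet R S u v : is_poset R -> is_poset S ->
  ((u, v) \in tc (Inc R :|: Inc S) :|: (Dec R :&: Dec S)) = premeet R S u v.
Proof.
case=> rR _ _ [rS _ _]; rewrite /premeet in_setU (@in_tc _ (step_inc R S)).
- case: leqP => uv; last first.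
    have -> : connect (step_inc R S) u v = false.
      by apply/negP=> /connect_step_inc_le; lia.
    by rewrite !inE /= (ltnW uv) !andbT.
  apply/orP/idP; last by left.
  case=> //; rewrite !inE /= => /andP [/andP [_ vu] _].
  have -> : u = v by apply: val_inj => /=; lia.
  exact: connect0.
- by move=> x y; rewrite !inE /= /step_inc -andb_orl andbC.
- by move=> x; rewrite /step_inc leqnn rR.
Qed.

Lemma in_meetT R S u v : is_poset R -> is_poset S ->
  (u, v) \in meetT R S <-> premeet R S u v /\
    (v <= u -> forall i j, i <= u -> v <= j -> premeet R S i u ->
       premeet R S v j -> premeet R S i j).
Proof.
move=> pR pS; rewrite /meetT /tdd in_setD in_premeet //.
have e := fun x y => in_premeet x y pR pS.
rewrite inE [in (u, v) \in Dec _]inE e /=.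
split=> [/andP [h p]|[p h]]; last rewrite p andbT.
  split=> // vu i j iu vj piu pvj; apply/negPn/negP=> pij; move/negP: h; apply.
  rewrite p vu /=; apply/existsP; exists i; apply/existsP; exists j.
  by rewrite iu vj !e piu pvj pij.
apply/negP=> /andP [/andP [_ vu]] /existsP [i /existsP [j]].
case/and5P=> iu vj; rewrite !e => p1 _ /andP [p2 /negP]; apply; exact: h.
Qed.

Lemma premeet_refl R S u : premeet R S u u.
Proof. by rewrite /premeet leqnn connect0. Qed.

Lemma premeet_inc R S u v w : u <= v -> v <= w ->
  premeet R S u v -> premeet R S v w -> premeet R S u w.
Proof.
move=> uv vw; rewrite /premeet uv vw (leq_trans uv vw); exact: connect_trans.
Qed.

Lemma premeet_dec R S u v w : is_poset R -> is_poset S -> v <= u -> w <= v ->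
  premeet R S u v -> premeet R S v w -> premeet R S u w.
Proof.
move=> [_ _ tR] [_ _ tS] vu wv.
case: (eqVneq u v) => [-> //|uv]; case: (eqVneq v w) => [-> //|vw].
have h1 : u <= v = false by move: uv; rewrite -val_eqE /=; lia.
have h2 : v <= w = false by move: vw; rewrite -val_eqE /=; lia.
have h3 : u <= w = false by lia.
rewrite /premeet h1 h2 h3 => /andP [a b] /andP [c d].
by rewrite (tR _ _ _ a c) (tS _ _ _ b d).
Qed.

Lemma meetT_poset R S : is_poset R -> is_poset S -> is_poset (meetT R S).
Proof.
move=> pR pS; have e := fun x y => in_meetT x y pR pS.
(* Increasing pairs survive [tdd]: only the diagonal is also decreasing, and there the pair (i, j)
   is a composite of increasing ones. *)
have inc (x y : 'I_n) : x <= y -> premeet R S x y -> (x, y) \in meetT R S.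
  move=> xy p; apply/e; split=> // yx i j ix yj.
  have -> : x = y by apply: val_inj => /=; lia.
  move=> h1 h2; apply: premeet_inc h1 h2 => //; lia.
(* When the direction changes at v, survival of the decreasing pair under [tdd] provides the
   composite: the other pair serves as its neighbour i or j. *)
have tr u v w : (u, v) \in meetT R S -> (v, w) \in meetT R S -> (u, w) \in meetT R S.
  move=> /e [p1 h1] /e [p2 h2].
  case: (leqP u v) => uv; case: (leqP v w) => vw.
  - apply: inc; [lia | exact: premeet_inc p1 p2].
  - apply/e; split; first by apply: (h2 (ltnW vw)) => //; exact: premeet_refl.
    move=> wu i j iu wj piu pwj; apply: (h2 (ltnW vw)) => //; first by lia.
    exact: premeet_inc piu p1.
  - apply/e; split; first by apply: (h1 (ltnW uv)) => //; exact: premeet_refl.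
    move=> wu i j iu wj piu pwj; apply: (h1 (ltnW uv)) => //; first by lia.
    exact: premeet_inc p2 pwj.
  - apply/e; split; first by apply: premeet_dec p1 p2 => //; exact: ltnW.
    move=> wu i j iu wj piu pwj.
    have piv : premeet R S i v.
      by apply: (h1 (ltnW uv)) => //; exact: premeet_refl.
    have pvj : premeet R S v j.
      by apply: (h2 (ltnW vw)) => //; exact: premeet_refl.
    case: (leqP i v) => iv; first exact: (h2 (ltnW vw)).
    case: (leqP v j) => jv; first exact: (h1 (ltnW uv)).
    apply: premeet_dec piv pvj => //; exact: ltnW.
(* By transitivity (v, x) is in the meet after the first step from u to x, so induction gives x = v.
   Then (u, v) lies in R or S while, if u < v, (v, u) lies in both. *)
have anti u v : u <= v -> connect (step_inc R S) u v -> (v, u) \in meetT R S -> u = v.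
  move=> uv c; move: u c uv; apply: connect_ind_left => // u x ux xv IH uv mvu.
  have xlv := connect_step_inc_le xv; have /andP [ulx ux'] := ux.
  have mux : (u, x) \in meetT R S.
    by apply: inc => //; rewrite /premeet ulx connect1.
  have xE := IH xlv (tr _ _ _ mvu mux); rewrite xE in ux' ulx.
  case: (ltnP u v) => uv'; last by apply: val_inj => /=; lia.
  have /e [+ _] := mvu; rewrite /premeet leqNgt uv' /= => /andP [vR vS].
  case: pR pS => [_ aR _] [_ aS _]; case/orP: ux' => h.
    exact: aR.
  exact: aS.
split=> [u|u v uv vu|//].
  by apply: inc => //; exact: premeet_refl.
case: (leqP u v) => h.
  by apply: anti => //; move: uv => /e [+ _]; rewrite /premeet h.
apply/esym/anti => //; first exact: ltnW.
by move: vu => /e [+ _]; rewrite /premeet (ltnW h).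
Qed.

Lemma meetT_inc_closed o R S : is_poset R -> is_poset S ->
  inc_closed o R -> inc_closed o S -> inc_closed o (meetT R S).
Proof.
move=> pR pS cR cS a b c ab bc /(in_meetT a c pR pS) [+ _].
rewrite /premeet (ltnW (ltn_trans ab bc)) => pac.
suff [h1 h2] : (b \in Oplus o -> connect (step_inc R S) a b) /\
  (b \in Ominus o -> connect (step_inc R S) b c).
  by split=> hb; apply/(in_meetT _ _ pR pS); rewrite /premeet;
    [rewrite (ltnW ab) | rewrite (ltnW bc)]; split; auto; lia.
move: a pac ab; apply: connect_ind_left => [|a x ax xc IH ab]; first by lia.
have c1 := connect1 ax.
case: (ltngtP x b) => [xb|bx|/val_inj xb].
- by have [h1 h2] := IH xb; split=> // /h1; exact: connect_trans.
- case/andP: ax => _ /orP [] ax.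
    have [h1 h2] := cR _ _ _ ab bx ax; split=> hb.
      by apply: connect1; rewrite /step_inc (ltnW ab) h1.
    apply: connect_trans xc; apply: connect1.
    by rewrite /step_inc (ltnW bx) h2.
  have [h1 h2] := cS _ _ _ ab bx ax; split=> hb.
    by apply: connect1; rewrite /step_inc (ltnW ab) h1 ?orbT.
  apply: connect_trans xc; apply: connect1.
  by rewrite /step_inc (ltnW bx) h2 ?orbT.
- by rewrite -xb.
Qed.

Definition prejoin R S u v : bool :=
  if v <= u then connect (step_dec R S) u v else ((u, v) \in R) && ((u, v) \in S).

Lemma in_prejoin R S u v : is_poset R -> is_poset S ->
  ((u, v) \in (Inc R :&: Inc S) :|: tc (Dec R :|: Dec S)) = prejoin R S u v.
Proof.
case=> rR _ _ [rS _ _]; rewrite /prejoin in_setU (@in_tc _ (step_dec R S)).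
- case: leqP => uv; last first.
    have -> : connect (step_dec R S) u v = false.
      by apply/negP=> /connect_step_dec_le; lia.
    by rewrite !inE /= (ltnW uv) !andbT orbF.
  apply/orP/idP; last by right.
  case=> //; rewrite !inE /= => /andP [/andP [_ vu] _].
  have -> : u = v by apply: val_inj => /=; lia.
  exact: connect0.
- by move=> x y; rewrite !inE /= /step_dec -andb_orl andbC.
- by move=> x; rewrite /step_dec leqnn rR.
Qed.

(* In the covering case, the union defining the join is already transitive,   *)
(* so that [tid] removes nothing: if R and S both contain (i, b), a step down *)
(* from b to some y > i cannot land on a minus node, by antisymmetry, so y is *)
(* a plus node and (i, y) is again in R and in S.                             *)
Section CoveringJoin.
Variables (o : orientation n) (R S : brel n).
Hypothesis (co : covering o) (pR : is_poset R) (pS : is_poset S).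
Hypothesis (cR : inc_closed o R) (cS : inc_closed o S).

Let both x y := ((x, y) \in R) && ((x, y) \in S).
Let q := prejoin R S.

Let prejoin_inc (x y : 'I_n) : x <= y -> both x y -> q x y.
Proof.
move=> xy b; rewrite /q /prejoin; case: leqP => // yx.
have -> : x = y by apply: val_inj => /=; lia.
exact: connect0.
Qed.

Let prejoin_dec (x y : 'I_n) : connect (step_dec R S) x y -> q x y.
Proof. by move=> xy; rewrite /q /prejoin (connect_step_dec_le xy). Qed.

Let step_down_inside (i b y : 'I_n) : i < y -> both i b -> step_dec R S b y -> both i y.
Proof.
case: pR pS => [_ aR _] [_ aS _].
move=> iy /andP [iR iS] /andP [yb bRS]; case: (ltnP y b) => yb'; last first.
  have -> : y = b by apply: val_inj => /=; lia.
  by rewrite /both iR iS.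
have [R1 R2] := cR iy yb' iR; have [S1 S2] := cS iy yb' iS.
case: (coveringP co iy yb') => oy; first by rewrite /both R1 // S1.
have h : y = b by case/orP: bRS => h; [apply: aR | apply: aS] => //; auto.
by move: yb'; rewrite h ltnn.
Qed.

Let step_up_inside (x a b : 'I_n) : x < b -> both a b -> step_dec R S x a -> both x b.
Proof.
case: pR pS => [_ aR _] [_ aS _].
move=> xb /andP [iR iS] /andP [ax aRS]; case: (ltnP a x) => ax'; last first.
  have -> : x = a by apply: val_inj => /=; lia.
  by rewrite /both iR iS.
have [R1 R2] := cR ax' xb iR; have [S1 S2] := cS ax' xb iS.
case: (coveringP co ax' xb) => oy; last by rewrite /both R2 // S2.
have h : x = a by case/orP: aRS => h; [apply: aR | apply: aS] => //; auto.
by move: ax'; rewrite h ltnn.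
Qed.

(** Follow the descending chain from b. While it stays above i, [step_down_inside] keeps the pair
    starting at i in both relations; the first step landing at or below i composes with that pair to
    a decreasing step from i. *)
Let prejoin_inc_dec (i b j : 'I_n) : i <= b -> both i b ->
  connect (step_dec R S) b j -> q i j.
Proof.
move=> ib iRS bj; move: b bj ib iRS; apply: connect_ind_left; first exact: prejoin_inc.
move=> b y bj yj IH ib iRS; case: (leqP y i) => yi; last first.
  by apply: IH; [exact: ltnW | exact: step_down_inside bj].
apply: prejoin_dec; apply: connect_trans yj; apply: connect1; rewrite /step_dec yi /=.
case: pR pS => [_ _ tR] [_ _ tS]; case/andP: iRS => iR iS.
by case/andP: bj => _ /orP [] h; rewrite ?(tR _ _ _ iR h) ?(tS _ _ _ iS h) ?orbT.
Qed.

Let prejoin_dec_inc (i a b : 'I_n) : a <= b -> both a b ->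
  connect (step_dec R S) i a -> q i b.
Proof.
move=> ab aRS ia; move: a ia ab aRS; apply: connect_ind_right; first exact: prejoin_inc.
move=> x a ix xa IH ab aRS; case: (leqP b x) => bx; last first.
  by apply: IH; [exact: ltnW | exact: step_up_inside xa].
apply: prejoin_dec; apply: connect_trans ix _; apply: connect1; rewrite /step_dec bx /=.
case: pR pS => [_ _ tR] [_ _ tS]; case/andP: aRS => aR aS.
by case/andP: xa => _ /orP [] h; rewrite ?(tR _ _ _ h aR) ?(tS _ _ _ h aS) ?orbT.
Qed.

Lemma prejoin_trans (u v w : 'I_n) : q u v -> q v w -> q u w.
Proof.
case: pR pS => [_ _ tR] [_ _ tS].
rewrite {1}/q /prejoin; case: leqP => uv huv; rewrite {1}/q /prejoin; case: leqP => vw hvw.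
- by apply: prejoin_dec; apply: connect_trans huv hvw.
- by apply: prejoin_dec_inc hvw huv; exact: ltnW.
- by apply: prejoin_inc_dec huv hvw; exact: ltnW.
- case/andP: huv => a b; case/andP: hvw => c d.
  apply: prejoin_inc; first by lia.
  by rewrite /both (tR _ _ _ a c) (tS _ _ _ b d).
Qed.

Lemma in_joinT (u v : 'I_n) : ((u, v) \in joinT R S) = q u v.
Proof.
rewrite /joinT /tid in_setD in_prejoin // -/q.
case quv : (q u v); rewrite ?andbF // andbT inE negb_and; apply/orP; right.
apply/existsP=> [[i /existsP [j]]].
case/and5P=> _ _; rewrite !in_prejoin // => h1 _ /andP [h2 /negP]; apply.
exact: prejoin_trans h1 (prejoin_trans quv h2).
Qed.

Lemma joinT_poset : is_poset (joinT R S).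
Proof.
have anti (i b : 'I_n) : i <= b -> both i b -> connect (step_dec R S) b i -> b = i.
  move=> ib iRS bi; move: b bi ib iRS; apply: connect_ind_left => // b y bj yi IH ib iRS.
  case: (ltnP i y) => iy.
    have := IH (ltnW iy) (step_down_inside iy iRS bj) => yE.
    by move: iy; rewrite yE ltnn.
  have yE : y = i by apply: val_inj => /=; have := connect_step_dec_le yi; lia.
  case: pR pS => [_ aR _] [_ aS _]; case/andP: iRS => iR iS.
  by case/andP: bj; rewrite yE => _ /orP [] h; [apply: aR | apply: aS].
split=> [u|u v|u v w]; rewrite !in_joinT.
- exact/prejoin_dec/connect0.
- rewrite /q /prejoin; case: ltngtP => [uv|uv|/val_inj //] h1 h2.
    by apply: anti => //; exact: ltnW.
  by apply/esym/anti => //; exact: ltnW.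
- exact: prejoin_trans.
Qed.

Lemma joinT_inc_closed : inc_closed o (joinT R S).
Proof.
move=> a b c ab bc; rewrite !in_joinT {1}/q /prejoin leqNgt (ltn_trans ab bc) /=.
case/andP=> hR hS; have [R1 R2] := cR ab bc hR; have [S1 S2] := cS ab bc hS.
by split=> hb; apply: prejoin_inc; rewrite /both ?(ltnW ab) ?(ltnW bc) ?R1 ?R2 ?S1 ?S2.
Qed.

End CoveringJoin.

(** Reversing arrows turns increasing chains into decreasing ones and the deletions of [tdd] into
    those of [tid]. *)
Lemma joinT_converse R S : is_poset R -> is_poset S ->
  joinT (converse R) (converse S) = converse (meetT R S).
Proof.
move=> pR pS; have cR := converse_poset pR; have cS := converse_poset pS.
have e (u v : 'I_n) : prejoin (converse R) (converse S) u v = premeet R S v u.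
  rewrite /prejoin /premeet !in_converse; case: leqP => // _.
  rewrite connect_rev; apply: eq_connect => x y.
  by rewrite /step_dec /step_inc !in_converse.
apply/setP=> [[u v]]; rewrite in_converse; apply/idP/idP.
  rewrite /joinT /tid in_setD in_prejoin // inE negb_and [in (u, v) \in Inc _]inE.
  rewrite in_prejoin // e /= => /andP [/orP h p]; apply/in_meetT => //; split=> //.
  move=> uv i j iv uj piv puj; apply/negPn/negP=> pij.
  case: h; first by rewrite p uv.
  case/negP; apply/existsP; exists j; apply/existsP; exists i.
  by rewrite !in_prejoin // !e uj iv puj p piv.
move/(in_meetT _ _ pR pS) => [p h].
rewrite /joinT /tid in_setD in_prejoin // e p andbT inE negb_and.
rewrite [in (u, v) \in Inc _]inE in_prejoin // e p /=.
case: leqP => //= uv; apply/existsP=> [[i /existsP [j]]].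
case/and5P => iu jv; rewrite !in_prejoin // !e => h1 h2 /negP; apply.
exact: h.
Qed.

Lemma meetT_converse R S : is_poset R -> is_poset S ->
  meetT (converse R) (converse S) = converse (joinT R S).
Proof.
move=> pR pS; rewrite -[LHS]converseK -joinT_converse ?converseK //;
exact: converse_poset.
Qed.

Definition inc_poset o R := is_poset R /\ inc_closed o R.
Definition dec_poset o R := is_poset R /\ dec_closed o R.

Lemma inc_poset_sublattice o : covering o -> induces_sublattice (inc_poset o).
Proof.
move=> co; split=> [R []//|R S [pR cR] [pS cS]]; split; split.
- exact: meetT_poset.
- exact: meetT_inc_closed.
- exact: (joinT_poset co).
- exact: joinT_inc_closed.
Qed.

Lemma dec_posetE o R : dec_poset o R <-> inc_poset (op_orientation o) (converse R).
Proof.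
split=> [[p /dec_closed_converse c]|[p c]]; split=> //.
- exact: converse_poset.
- by rewrite -[R]converseK; exact: converse_poset.
- exact/dec_closed_converse.
Qed.

Lemma dec_poset_sublattice o : covering o -> induces_sublattice (dec_poset o).
Proof.
move=> co; split=> [R []//|R S hR hS]; have pR := hR.1; have pS := hS.1.
have [_ h] := inc_poset_sublattice (op_covering co).
move/dec_posetE: hR => hR; move/dec_posetE: hS => hS.
have [h1 h2] := h _ _ hR hS.
by split; apply/dec_posetE; rewrite -?joinT_converse -?meetT_converse.
Qed.

End MeetJoin.

(** * Linear extensions *)

Section LinearExtensions.
Variable n : nat.
Implicit Types (R S : brel n) (o : orientation n) (s t : 'S_n).

(** Positions are ranks: u is preceded by the labels of smaller key. *)
Lemma perm_of_key (K : 'I_n -> nat) : injective K ->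
  exists s, forall u v, (pos s u <= pos s v) = (K u <= K v).
Proof.
move=> Kinj; pose below u := [set v : 'I_n | K v < K u].
have lt_n u : #|below u| < n.
  rewrite -[X in _ < X]card_ord -cardsT; apply: proper_card; apply/properP.
  by split; [exact: subsetT | exists u; rewrite !inE // ltnn].
pose f u := Ordinal (lt_n u).
have fE u v : (f u <= f v) = (K u <= K v).
  apply/idP/idP; last first.
    by move=> uv; apply/subset_leq_card/subsetP=> x; rewrite !inE; lia.
  apply: contraTT; rewrite -!ltnNge => vu; apply: proper_card; apply/properP.
  by split; [apply/subsetP=> x; rewrite !inE; lia | exists v; rewrite !inE ?ltnn].
have finj : injective f.
  move=> u v fuv; apply: Kinj; apply/eqP.
  by rewrite eqn_leq -!fE fuv leqnn.
(* The rank function sends values to positions, hence the inverse. *)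
by exists (perm finj)^-1%g => u v; rewrite /pos invgK !permE fE.
Qed.

Lemma pos_inj s : injective (pos s).
Proof. exact: perm_inj. Qed.

Lemma pos_lt s u v : (pos s u < pos s v) = (u != v) && (pos s u <= pos s v).
Proof.
by rewrite ltn_neqAle; congr (~~ _ && _); rewrite val_eqE (inj_eq (@pos_inj s)).
Qed.

Lemma rev_perm s : exists t, forall u v, (pos t u <= pos t v) = (pos s v <= pos s u).
Proof.
have [|t tE] := @perm_of_key (fun u => n - pos s u).
  move=> u v; have := ltn_ord (pos s u); have := ltn_ord (pos s v) => hu hv h.
  by apply: (@pos_inj s); apply: val_inj => /=; lia.
exists t => u v; rewrite tE.
by have := ltn_ord (pos s u); have := ltn_ord (pos s v); lia.
Qed.

Lemma linear_extensionP R s :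
  linear_extension R s <-> forall u v, (u, v) \in R -> pos s u <= pos s v.
Proof.
split=> [/subsetP h u v /h|h]; first by rewrite inE.
by apply/subsetP=> [[u v]] /h; rewrite inE.
Qed.

Lemma linear_extension_exists R : is_poset R -> exists s, linear_extension R s.
Proof.
case=> r a t; pose down u := [set v | (v, u) \in R].
(* The size of the down-set decides; the label, being less than n, only breaks ties. *)
have [|s sE] := @perm_of_key (fun u => #|down u| * n + u).
  move=> u v h; apply: val_inj => /=.
  by rewrite -(modn_small (ltn_ord u)) -(modn_small (ltn_ord v)) -(modnMDl #|down u|) h modnMDl.
exists s; apply/linear_extensionP=> u v uv; rewrite sE.
case: (eqVneq u v) => [-> //|uNv].
suff lt : #|down u| < #|down v|.
  apply: (@leq_trans (#|down u|.+1 * n)); last first.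
    by apply: (leq_trans _ (leq_addr _ _)); rewrite leq_mul2r lt orbT.
  by rewrite mulSn addnC leq_add2r ltnW.
apply: proper_card; apply/properP; split.
  by apply/subsetP=> x; rewrite !inE => xu; exact: t xu uv.
exists v; rewrite !inE //; apply/negP=> vu.
by move/eqP: uNv; apply; exact: a.
Qed.

Lemma linear_extension_swap R (a c : 'I_n) : is_poset R -> (a, c) \notin R ->
  exists2 s, linear_extension R s & pos s c < pos s a.
Proof.
move=> [r anti tr] ac.
(* The transitive closure of R with (c, a) added; a failure of antisymmetry would put (a, c) in
   R. *)
pose R' : brel n := R :|: [set p : 'I_n * 'I_n | ((p.1, c) \in R) && ((a, p.2) \in R)].
have inR' u v : ((u, v) \in R') = ((u, v) \in R) || (((u, c) \in R) && ((a, v) \in R)).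
  by rewrite !inE.
have pR' : is_poset R'.
  split=> [u|u v|u v w]; rewrite !inR' ?r //.
    case/orP=> [h1|/andP [h1 h2]] /orP [h3|/andP [h3 h4]]; first exact: anti.
    - by case/negP: ac; exact: (tr _ _ _ h4 (tr _ _ _ h1 h3)).
    - by case/negP: ac; exact: (tr _ _ _ (tr _ _ _ h2 h3) h1).
    - by case/negP: ac; apply: tr h4 h1.
  case/orP=> [h1|/andP [h1 h2]] /orP [h3|/andP [h3 h4]].
  - by rewrite (tr _ _ _ h1 h3).
  - by rewrite (tr _ _ _ h1 h3) h4 orbT.
  - by rewrite h1 (tr _ _ _ h2 h3) orbT.
  - by rewrite h1 h4 orbT.
have [s /linear_extensionP h] := linear_extension_exists pR'.
exists s; first by apply/linear_extensionP=> u v uv; apply: h; rewrite inR' uv.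
rewrite pos_lt h ?inR' ?r ?orbT // andbT.
by apply: contraNN ac => /eqP ->.
Qed.

(** If (a, c) is not in R, some linear extension inverts it, hence so does the maximal one. *)
Lemma max_linear_extension_inc R s (a c : 'I_n) : is_poset R ->
  max_linear_extension R s -> a < c -> ((a, c) \in R) = (pos s a < pos s c).
Proof.
move=> pR [/linear_extensionP hs hmax] ac; apply/idP/idP.
  by move/hs; rewrite pos_lt => ->; rewrite andbT -val_eqE /= neq_ltn ac.
apply: contraTT => /(linear_extension_swap pR) [t ht tca].
by have := hmax _ ht _ _ ac tca; lia.
Qed.

(** The candidate is [L], which inverts every pair that R does not force to be increasing. Beyond
    transitivity of R, transitivity of [L] needs that a R c implies a R b or b R c for a < b < c,
    which covering and closure give. *)
Lemma max_linear_extension_exists o R : covering o -> inc_poset o R ->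
  exists s, max_linear_extension R s.
Proof.
move=> co [[r anti t] c].
pose L (u v : 'I_n) := if u <= v then (u, v) \in R else (v, u) \notin R.
have Lrefl u : L u u by rewrite /L leqnn.
have Ltot u v : L u v || L v u.
  rewrite /L; case: ltngtP => uv; rewrite ?orbN ?orNb //.
  by rewrite (val_inj uv) r.
have Lanti u v : L u v -> L v u -> u = v.
  by rewrite /L; case: ltngtP => [uv h /negP|uv /negP h|/val_inj] //.
have Ltr u v w : L u v -> L v w -> L u w.
  case: (eqVneq u v) => [-> //|uv]; case: (eqVneq v w) => [-> //|vw].
  case: (eqVneq u w) => [-> //|uw]; rewrite -!val_eqE /= in uv vw uw.
  have between (x y z : 'I_n) : x < y -> y < z -> (x, z) \in R ->
      ((x, y) \in R) || ((y, z) \in R).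
    move=> xy yz xz; have [h1 h2] := c _ _ _ xy yz xz.
    by case: (coveringP co xy yz) => [/h1 ->|/h2 ->]; rewrite ?orbT.
  rewrite /L; case: leqP => luv; case: leqP => lvw; case: leqP => luw.
  - exact: t.
  - by lia.
  - have := between u w v; move=> b huv /negP hvw.
    have /orP [//|] := b ltac:(lia) ltac:(lia) huv.
    by move/hvw.
  - move=> huv /negP hwv; apply/negP=> hwu; apply: hwv; exact: t hwu huv.
  - move=> /negP hvu hvw; have /orP [|//] := between v u w ltac:(lia) ltac:(lia) hvw.
    by move/hvu.
  - move=> /negP hvu hvw; apply/negP=> hwu; apply: hvu; exact: t hvw hwu.
  - by lia.
  - move=> /negP hvu /negP hwv; apply/negP=> hwu.
    by have /orP [] := between w v u ltac:(lia) ltac:(lia) hwu.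
pose down u := [set v | L v u].
have sub u v : L u v -> #|down u| <= #|down v|.
  by move=> uv; apply/subset_leq_card/subsetP=> x; rewrite !inE => xu; exact: Ltr uv.
have lt u v : L u v -> u != v -> #|down u| < #|down v|.
  move=> uv uNv; apply: proper_card; apply/properP; split.
    by apply/subsetP=> x; rewrite !inE => xu; exact: Ltr uv.
  exists v; rewrite !inE //; apply/negP=> vu.
  by move/eqP: uNv; apply; exact: Lanti.
have le u v : (#|down u| <= #|down v|) = L u v.
  apply/idP/idP; last exact: sub.
  case/orP: (Ltot u v) => // vu; case: (eqVneq v u) => [-> //|/lt] => /(_ vu); lia.
have [|s sE] := @perm_of_key (fun u => #|down u|).
  by move=> u v h; apply: Lanti; rewrite -le h.
exists s; split=> [|u /linear_extensionP hu a b ab hab].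
  apply/linear_extensionP=> u v uv; rewrite sE le /L; case: leqP => // vu.
  by apply/negP=> h; move: vu; rewrite (anti _ _ uv h) ltnn.
have abN : (a, b) \notin R by apply/negP=> /hu; lia.
rewrite pos_lt sE le /L leqNgt ab /= abN andbT.
by rewrite -val_eqE /= neq_ltn ab orbT.
Qed.

(** In the maximal extension an increasing pair is in order exactly when it belongs to R, so
    avoiding b a c at a plus node says that a R c implies a R b, and avoiding a c b at a minus node
    that it implies b R c. *)
Lemma IPIP_inc_poset o R : covering o -> IPIP o R <-> inc_poset o R.
Proof.
move=> co; split.
  case=> pR [s [ms av]]; split=> // a b c ab bc.
  have E := fun x y => @max_linear_extension_inc R s x y pR ms.
  have ac := ltn_trans ab bc; have [a1 a2] := av _ _ _ ab bc.
  rewrite !E // => pac; have nab : a != b by rewrite -val_eqE /=; lia.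
  have nbc : b != c by rewrite -val_eqE /=; lia.
  split=> [/a1|/a2] h; apply/negPn/negP => h'; apply: h; rewrite /appear pac ?andbT //=.
    by rewrite pos_lt eq_sym nab leqNgt.
  by rewrite pos_lt eq_sym nbc leqNgt.
move=> ip; have [s ms] := max_linear_extension_exists co ip.
have [pR c] := ip; split=> //; exists s; split=> // a b d ab bd.
have E := fun x y => @max_linear_extension_inc R s x y pR ms.
have := c _ _ _ ab bd; rewrite !E ?(ltn_trans ab bd) // => cc.
split=> hb /andP [h1 h2].
  by have [c1 _] := cc h2; have := c1 hb; lia.
by have [_ c2] := cc h1; have := c2 hb; lia.
Qed.

Lemma perm_le_rev s t s' t' :
  (forall u v, (pos s' u <= pos s' v) = (pos s v <= pos s u)) ->
  (forall u v, (pos t' u <= pos t' v) = (pos t v <= pos t u)) ->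
  perm_le s t -> perm_le t' s'.
Proof.
move=> sE tE h a b ab; rewrite !ltnNge tE sE -!ltnNge => hab.
rewrite pos_lt -val_eqE /= neq_ltn ab /= leqNgt; apply/negP=> sba.
by have := h _ _ ab sba; lia.
Qed.

Lemma linear_extension_rev R s s' :
  (forall u v, (pos s' u <= pos s' v) = (pos s v <= pos s u)) ->
  linear_extension (converse R) s' <-> linear_extension R s.
Proof.
by move=> sE; split=> /linear_extensionP h; apply/linear_extensionP=> u v;
  [have := h v u; rewrite in_converse sE | rewrite in_converse sE; exact: h].
Qed.

(** Reading backwards turns linear extensions of R into those of its converse and reverses the weak
    order. *)
Lemma min_linear_extension_rev R s s' :
  (forall u v, (pos s' u <= pos s' v) = (pos s v <= pos s u)) ->
  min_linear_extension R s <-> max_linear_extension (converse R) s'.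
Proof.
move=> sE; split=> [] [le hm]; split; try exact/(linear_extension_rev _ sE).
- move=> t' ht'; have [t tE] := rev_perm t'.
  have tE' u v : (pos t' u <= pos t' v) = (pos t v <= pos t u) by rewrite tE.
  apply: (perm_le_rev sE tE'); apply: hm; exact/(linear_extension_rev _ tE').
- move=> t ht; have [t' tE] := rev_perm t.
  have tE' u v : (pos t u <= pos t v) = (pos t' v <= pos t' u) by rewrite tE.
  have sE' u v : (pos s u <= pos s v) = (pos s' v <= pos s' u) by rewrite sE.
  apply: (perm_le_rev tE' sE'); apply: hm; exact/(linear_extension_rev _ tE).
Qed.

(** Read backwards, b c a and c a b become a c b and b a c, the patterns of IPIP for the opposite
    orientation. *)
Lemma DPIP_dec_poset o R : covering o -> DPIP o R <-> dec_poset o R.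
Proof.
move=> co; rewrite dec_posetE; have := IPIP_inc_poset (converse R) (op_covering co).
move=> <-.
have appE s s' x y z : (forall u v, (pos s' u <= pos s' v) = (pos s v <= pos s u)) ->
    appear s' x y z -> appear s z y x.
  by move=> sE; rewrite /appear !ltnNge !sE andbC.
split=> [] [pR [s [ms av]]].
  split; first exact: converse_poset.
  have [s' sE] := rev_perm s; exists s'; split; first exact/(min_linear_extension_rev _ sE).
  move=> a b c ab bc; have [h1 h2] := av _ _ _ ab bc.
  by split=> hb /(appE _ _ _ _ _ sE); [apply: h2 | apply: h1].
split; first by rewrite -[R]converseK; exact: converse_poset.
have [s' sE] := rev_perm s; exists s'.
have sE' u v : (pos s u <= pos s v) = (pos s' v <= pos s' u) by rewrite sE.
split; first exact/(min_linear_extension_rev _ sE').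
move=> a b c ab bc; have [h1 h2] := av _ _ _ ab bc.
by split=> hb /(appE _ _ _ _ _ sE); [apply: h2 | apply: h1].
Qed.

Lemma min_linear_extension_exists o R : covering o -> dec_poset o R ->
  exists s, min_linear_extension R s.
Proof. by move=> co /(DPIP_dec_poset R co) [_ [s [? _]]]; exists s. Qed.

Lemma min_linear_extension_dec R s (a c : 'I_n) : is_poset R ->
  min_linear_extension R s -> a < c -> ((c, a) \in R) = (pos s c < pos s a).
Proof.
move=> pR ms ac; have [s' sE] := rev_perm s.
rewrite -in_converse (@max_linear_extension_inc _ s') // ?ltnNge ?sE //.
  exact: converse_poset.
exact/(min_linear_extension_rev _ sE).
Qed.

End LinearExtensions.

(** * Permutrees *)

Section PermutreePosets.
Variable n : nat.
Implicit Types (o : orientation n) (T : slotted_graph n) (u v w x y b : 'I_n).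

Lemma edgeP T u v : reflect (exists s, parent T u s = Some v) (edge T u v).
Proof.
apply: (iffP idP); rewrite /edge /=.
  by case/or4P => // /eqP h; [exists Left | exists Mid | exists Right].
by case=> [[]] ->; rewrite eqxx ?orbT.
Qed.

Lemma path_avoid T v w p : v \notin w :: p -> path (adj T) w p ->
  in_subtree T v w (last w p).
Proof.
move=> vp pp; apply/connectP; exists p => //; elim: p w vp pp => //= x p IH w.
rewrite !inE !negb_or => /and3P [vw vx vp] /andP [-> px] /=.
by rewrite eq_sym vw eq_sym vx IH // inE negb_or vx.
Qed.

(** The directed path either meets v or stays in one component of the tree without v. *)
Lemma directed_avoid T v x y : connect (edge T) x y ->
  connect (edge T) x v \/ in_subtree T v x y.
Proof.
move: y; apply: connect_ind_right; first by right; exact: connect0.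
move=> w y xw wy [|h]; first by left.
case: (eqVneq w v) => [wv|wv]; first by left; rewrite -wv.
case: (eqVneq y v) => [yv|yv].
  by left; rewrite -yv; apply: connect_trans xw (connect1 wy).
by right; apply: connect_trans h (connect1 _); rewrite /adj wy wv yv.
Qed.

(* On a simple path from b to x, the first node v entered from a child and    *)
(* left towards a parent has two parents, hence separates b from x and y,     *)
(* although b lies between x and y. So the path only goes down from b to x.   *)
Lemma tree_rel_plus o T b x y : is_permutree o T -> b \in Oplus o ->
  (x < b < y) || (y < b < x) -> connect (edge T) x y -> connect (edge T) x b.
Proof.
case=> [[_ conn _] _ _ slots side] bO bxy xy.
apply/negPn/negP=> /negP nxb.
have has_parent v s w : parent T v s = Some w -> has_slot (v \in Oplus o) s.
  by move=> h; apply/negPn/negP=> /(slots v s).1; rewrite h.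
(* Invariant along the simple path: [r] climbs from v to b, and [q] is what remains from v to x. *)
suff walk q v r : path (edge T) v r -> last v r = b ->
    path (adj T) v q -> last v q = x -> uniq (r ++ v :: q) -> connect (edge T) x b.
  have /connectP [p pp lp] := conn b x.
  case/shortenP: pp lp => p' pp' up' _ lp'.
  by apply: nxb; apply: (@walk p' b [::]).
elim: q v r => [|w q IH] v r pr lr.
  by move=> _ /= <- _; apply/connectP; exists r.
move=> /= /andP [vw pq] lq un.
have vb : connect (edge T) v b by apply/connectP; exists r.
have vq : v \notin w :: q.
  by move: un; rewrite cat_uniq => /and3P [_ _] /= /andP [].
have wx : in_subtree T v w x by rewrite -lq; exact: path_avoid.
(* The path from x to y avoids v, since otherwise x would reach b through v; so y lies on the same
   side as x. *)
have wy : in_subtree T v w y.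
  case: (directed_avoid v xy) => [xv|]; last exact: connect_trans.
  by case: nxb; exact: connect_trans xv vb.
case/orP: vw => vw; last first.
  apply: (IH w (v :: r)) => //=; first by rewrite vw.
  by move: un; rewrite -[v :: w :: q]cat1s uniq_catCA.
case/edgeP: vw => s ps.
have vr : v \notin r.
  by move: un; rewrite cat_uniq => /and3P [_ /hasPn h _]; apply: h; rewrite inE eqxx.
case: r pr lr un vb vr => [|p r] /=.
  move=> _ vE _ _ _; have := has_parent _ _ _ ps.
  rewrite vE in ps wx wy *; rewrite bO; have := side _ _ _ wx; have := side _ _ _ wy.
  case: s ps => // ps [h1 h2 _ _] [h3 h4 _ _] _.
    by move: (h1 bO ps) (h3 bO ps) bxy; clear; lia.
  by move: (h2 bO ps) (h4 bO ps) bxy; clear; lia.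
case/andP=> /edgeP [s' ps'] pr lr un vb vr.
have pw : p != w.
  apply: contraTneq un => ->; by rewrite mem_cat !inE eqxx !orbT.
have pb : in_subtree T v p b.
  rewrite -lr; apply: path_avoid => //; apply: sub_path pr => u z.
  by rewrite /adj => ->.
have hs := has_parent _ _ _ ps; have hs' := has_parent _ _ _ ps'.
have vO : v \in Oplus o.
  apply/negPn/negP=> /negbTE vO; move: hs hs' ps ps'; rewrite vO.
  by case: s => //; case: s' => // _ _ -> [] h; rewrite h eqxx in pw.
have := side _ _ _ wx; have := side _ _ _ wy; have := side _ _ _ pb.
case=> b1 b2 _ _ [y1 y2 _ _] [x1 x2 _ _].
move: hs hs' ps ps'; rewrite vO; case: s => //; case: s' => // _ _ ps ps'.
- by move: ps'; rewrite ps => [[]] h; rewrite h eqxx in pw.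
- by move: (b2 vO ps') (y1 vO ps) (x1 vO ps) bxy; clear; lia.
- by move: (b1 vO ps') (y2 vO ps) (x2 vO ps) bxy; clear; lia.
- by move: ps'; rewrite ps => [[]] h; rewrite h eqxx in pw.
Qed.

Definition op_graph T := SlottedGraph (child T) (parent T).

Lemma op_edge o T u v : is_permutree o T -> edge (op_graph T) u v = edge T v u.
Proof. by case=> _ h _ _ _; apply/edgeP/edgeP => /(h v u). Qed.

Lemma op_adj o T u v : is_permutree o T -> adj (op_graph T) u v = adj T u v.
Proof. by move=> h; rewrite /adj !(op_edge _ _ h) orbC. Qed.

(** Turning the tree upside down exchanges parents with children and keeps all labels and
    components. *)
Lemma op_permutree o T : is_permutree o T -> is_permutree (op_orientation o) (op_graph T).
Proof.
move=> hT; have aE u v := op_adj u v hT; have eE u v := op_edge u v hT.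
case: (hT) => [[asym conn acyc] pc inj slots side]; split=> //=.
- split=> [u v|u v|c].
  + by rewrite !eE; exact: asym.
  + by rewrite (eq_connect aE).
  + by rewrite /ucycle /ucycleb (eq_cycle aE); exact: acyc.
- by move=> u v; split=> /(pc v u).
- by move=> v s t w; have [h1 h2] := inj v s t w.
- by move=> v s; have [h1 h2] := slots v s.
- move=> v w u; rewrite /in_subtree.
  have -> : connect (fun x y => [&& adj (op_graph T) x y, x != v & y != v]) w u =
      connect (fun x y => [&& adj T x y, x != v & y != v]) w u.
    by apply: eq_connect => x y; rewrite aE.
  by move/side => [].
Qed.

Lemma tree_rel_minus o T b x y : is_permutree o T -> b \in Ominus o ->
  (x < b < y) || (y < b < x) -> connect (edge T) x y -> connect (edge T) b y.
Proof.
move=> hT bO bxy xy; have E u v : connect (edge (op_graph T)) u v = connect (edge T) v u.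
  by rewrite connect_rev; apply: eq_connect => z t; exact: (op_edge t z hT).
rewrite -E; apply: (tree_rel_plus (op_permutree hT) bO (y := x)); first by rewrite orbC.
by rewrite E.
Qed.

Lemma in_tree_rel T u v : ((u, v) \in tree_rel T) = connect (edge T) u v.
Proof. by rewrite inE. Qed.

Lemma tree_rel_inc_closed o T : is_permutree o T -> inc_closed o (tree_rel T).
Proof.
move=> hT a b c ab bc; rewrite !in_tree_rel => ac; split=> hb.
  by apply: tree_rel_plus hT hb _ ac; rewrite ab bc.
by apply: tree_rel_minus hT hb _ ac; rewrite ab bc.
Qed.

Lemma tree_rel_dec_closed o T : is_permutree o T -> dec_closed o (tree_rel T).
Proof.
move=> hT a b c ab bc; rewrite !in_tree_rel => ac; split=> hb.
  by apply: tree_rel_plus hT hb _ ac; rewrite ab bc orbT.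
by apply: tree_rel_minus hT hb _ ac; rewrite ab bc orbT.
Qed.

(** Closure passes to intersections; antisymmetry comes from the linear extension of T provided by
    [permutree_le]. *)
Lemma PIP_inc_dec_poset o (R : brel n) : PIP o R -> inc_poset o R /\ dec_poset o R.
Proof.
case=> T [T' [hT hT' [s [s' [/linear_extensionP hs _ _]]] ->]].
have pR : is_poset (tree_rel T :&: tree_rel T').
  split=> [u|u v|u v w]; rewrite !in_setI !in_tree_rel ?connect0 //.
    move=> /andP [uv _] /andP [vu _]; rewrite -!in_tree_rel in uv vu.
    by apply: (@pos_inj _ s); apply: val_inj => /=; have := hs _ _ uv; have := hs _ _ vu; lia.
  by move=> /andP [a b] /andP [c d]; rewrite (connect_trans a c) (connect_trans b d).
split; split=> // a b c ab bc; rewrite !in_setI => /andP [h h'].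
  have [h1 h2] := tree_rel_inc_closed hT ab bc h.
  have [h3 h4] := tree_rel_inc_closed hT' ab bc h'.
  by split=> hb; apply/andP; auto.
have [h1 h2] := tree_rel_dec_closed hT ab bc h.
have [h3 h4] := tree_rel_dec_closed hT' ab bc h'.
by split=> hb; apply/andP; auto.
Qed.

End PermutreePosets.

(** * Plane drawings of trees *)

Definition between (x b y : nat) : bool := (x < b < y) || (y < b < x).

(* [e] is drawn in the plane with the label of a node as abscissa and [k] as  *)
(* height; vertical walls rise from the nodes of [Op] and hang below those    *)
(* of [Om], and no edge crosses a wall.                                       *)
Section TreeDrawing.
Variables (n : nat) (e : rel 'I_n) (k : 'I_n -> nat) (Op Om : {set 'I_n}).
Hypothesis k_inj : injective k.
Hypothesis e_up : forall u w, e u w -> k u < k w.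
Hypothesis e_plus : forall u w b : 'I_n, e u w -> between u b w -> b \in Op -> k w < k b.
Hypothesis e_minus : forall u w b : 'I_n, e u w -> between u b w -> b \in Om -> k b < k u.
Hypothesis e_parents : forall u p p' : 'I_n, e u p -> e u p' -> p != p' ->
  u \in Op /\ between p u p'.
Hypothesis e_children : forall w u u' : 'I_n, e u w -> e u' w -> u != u' ->
  w \in Om /\ between u w u'.

Let a : rel 'I_n := fun u v => e u v || e v u.

Let between_sym (x b y : nat) : between x b y = between y b x.
Proof. by rewrite /between orbC. Qed.

Let lt_k_neq (x y : 'I_n) : k x < k y -> x != y :> nat.
Proof. by apply: contraTneq => /val_inj ->; rewrite ltnn. Qed.

(** A path that stays higher than z cannot cross the wall rising from z. *)
Let same_side_plus (z x : 'I_n) p : z \in Op -> path a x p -> all (fun y => k z < k y) (x :: p) ->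
  ~~ between x z (last x p).
Proof.
move=> zO; elim: p x => [|y p IH] x /=; first by rewrite /between; lia.
move=> /andP [axy pp] /andP [zx h]; have /andP [zy _] := h.
have := IH _ pp h; have := lt_k_neq zx; have := lt_k_neq zy.
suff : ~~ between x z y by rewrite /between; lia.
apply/negP=> b; case/orP: axy => exy.
  by have := e_plus exy b zO; lia.
by have := e_plus exy _ zO; rewrite between_sym b => /(_ isT); lia.
Qed.

Let same_side_minus (z x : 'I_n) p : z \in Om -> path a x p -> all (fun y => k y < k z) (x :: p) ->
  ~~ between x z (last x p).
Proof.
move=> zO; elim: p x => [|y p IH] x /=; first by rewrite /between; lia.
move=> /andP [axy pp] /andP [zx h]; have /andP [zy _] := h.
have := IH _ pp h; have := lt_k_neq zx; have := lt_k_neq zy.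
suff : ~~ between x z y by rewrite /between; lia.
apply/negP=> b; case/orP: axy => exy.
  by have := e_minus exy b zO; lia.
by have := e_minus exy _ zO; rewrite between_sym b => /(_ isT); lia.
Qed.

Let e_down x y : a x y -> k x < k y -> e x y.
Proof. by case/orP => // /e_up; lia. Qed.

(* The two neighbours of the top of a cycle would be its left and right       *)
(* children, and the rest of the cycle would pass below it.                   *)
Lemma drawing_acyclic c : ucycle a c -> size c < 3.
Proof.
move=> /andP [cc uc]; rewrite ltnNge; apply/negP=> sc.
have [v0 v0c] : exists v0, v0 \in c.
  by case: c sc {cc uc} => // v0 c _; exists v0; rewrite inE eqxx.
case: (@arg_maxnP _ v0 (mem c) k v0c) => v vc vmax.
have [i c' rc] := rot_to vc.
have {uc} : uniq (v :: c') by rewrite -rc rot_uniq.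
have {cc} : path.cycle a (v :: c') by rewrite -rc rot_cycle.
have {sc} : 2 < size (v :: c') by rewrite -rc size_rot.
have {vc vmax} : forall y, y \in v :: c' -> k y <= k v.
  by move=> y; rewrite -rc mem_rot; exact: vmax.
case: c' {rc} => // x [|x' c''] // vmax _.
set p := x' :: c''; rewrite [path.cycle _ _]/= rcons_path.
move=> /and4P [avx axx' pp' apv] un; have pp : path a x p by rewrite /= axx'.
have lt y : y \in x :: p -> k y < k v.
  move=> yp; have yv : k y <= k v by apply: vmax; rewrite inE; apply/orP; right.
  rewrite ltn_neqAle yv andbT.
  apply: contraTneq un => /k_inj yE; by rewrite cons_uniq -yE yp.
have xlast : last x p \in p by exact: (mem_last x' c'').
have ex : e x v by apply: e_down; [rewrite /a orbC | rewrite lt ?inE ?eqxx].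
have ey : e (last x p) v by apply: e_down apv _; apply: lt; rewrite inE xlast orbT.
have [|vO b] := e_children ex ey.
  apply: contraTneq un => xE; rewrite /= -/p.
  have -> : x \in p by rewrite {1}xE.
  by rewrite andbF.
move/negP: (same_side_minus vO pp (introT allP lt)); exact.
Qed.

(* A path leaving v through a child and crossing the abscissa of v does so    *)
(* above v; its lowest node z is then a plus node, with v on one side and the *)
(* crossing edge on the other, which is absurd.                               *)
Lemma drawing_child_side (v w u : 'I_n) : v \in Om -> e w v ->
  connect (fun x y => [&& a x y, x != v & y != v]) w u -> ~~ between w v u /\ u != v.
Proof.
move=> vO ewv; have wv := e_up ewv.
suff main p : path a w p -> uniq [:: v, w & p] -> ~~ between w v (last w p).
  move=> c; have uv : u != v.
    move: u c; apply: connect_ind_right; last by move=> x y _ /and3P [].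
    by rewrite -val_eqE; exact: lt_k_neq.
  split=> //; case/connectP: c => p pp ->; case/shortenP: pp => p' pp' up' _.
  apply: main; first by apply: sub_path pp' => x y /and3P [].
  rewrite cons_uniq up' andbT; apply/negP; rewrite inE => /orP [/eqP h|].
    by move: wv; rewrite h ltnn.
  elim: p' w pp' {up' ewv wv} => //= y p' IH x /andP [/and3P [_ _ yv] pp'].
  by rewrite inE => /orP [/eqP h|]; [rewrite h eqxx in yv | exact: IH pp'].
(* By induction the path up to x stays on the side of w, so x y is the first edge that crosses. *)
elim/last_ind: p => [|p y IH]; first by rewrite /between /=; lia.
rewrite rcons_path last_rcons => /andP [pp axy].
rewrite -!rcons_cons rcons_uniq => /andP [yn un].
have {IH} IH := IH pp un; set x := last w p in axy IH.
have xin : x \in w :: p by exact: mem_last.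
have xv : x != v :> nat.
  rewrite val_eqE; apply: contraTneq un => xv; by rewrite cons_uniq -xv xin.
have yv : y != v :> nat.
  by rewrite val_eqE; apply: contraNneq yn => ->; rewrite inE eqxx.
apply/negP=> bwy; have bxy : between x v y.
  by move: IH bwy xv yv; rewrite /between; clear; lia.
have [vx vy] : k v < k x /\ k v < k y.
  case/orP: axy => exy.
    by have h := e_minus exy bxy vO; split=> //; exact: ltn_trans h (e_up exy).
  rewrite between_sym in bxy.
  by have h := e_minus exy bxy vO; split=> //; exact: ltn_trans h (e_up exy).
have win : w \in w :: p by rewrite inE eqxx.
(* The lowest node z lies below v because w does, so the crossing edge, above v, is also above z. *)
case: (@arg_minnP _ w (mem (w :: p)) k win) => z zin zmin.
have h1 : k z < k v := leq_ltn_trans (zmin _ win) wv.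
have avp : path a v (w :: p) by rewrite /= pp /a ewv orbT.
have lp : last v (w :: p) = x by [].
have {}zmin t : t \in w :: p -> t != z -> k z < k t.
  move=> tin tz; rewrite ltn_neqAle zmin // andbT; apply: contraNneq tz => h.
  by apply/eqP/k_inj.
have {}zin : z \in w :: p by [].
case/splitPr: zin zmin un avp lp yn => p1 p2 zmin un.
rewrite cat_path last_cat /= => /and3P [pp1 apz pp2] lp yn.
have := un; rewrite -cat_cons cat_uniq => /and3P [_ /hasPn dis /andP [uz' _]].
have uz : z \notin v :: p1 by apply: dis; rewrite inE eqxx.
case: p2 pp2 lp zmin dis uz' {un yn} => [|z' p2].
  by move=> _ /= lp; have := ltn_trans h1 vx; rewrite -lp ltnn.
rewrite [path _ _ _]/= => /andP [azz' pp2] lp zmin dis uz'; rewrite /= in lp.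
have all1 : all (fun t => k z < k t) (v :: p1).
  apply/allP=> t tin; move: (tin); rewrite inE => /orP [/eqP -> //|tp1].
  apply: zmin; first by rewrite mem_cat tp1.
  by apply: contraNneq uz => <-.
have all2 : all (fun t => k z < k t) (z' :: p2).
  apply/allP=> t tin; apply: zmin; first by rewrite mem_cat inE tin !orbT.
  by apply: contraNneq uz' => <-.
have all3 : all (fun t => k z < k t) (z' :: rcons p2 y).
  by rewrite -rcons_cons all_rcons all2 andbT (ltn_trans h1 vy).
have lin : last v p1 \in v :: p1 by exact: mem_last.
have ep : e z (last v p1).
  by apply: e_down; [rewrite /a orbC | exact: (allP all1)].
have ez : e z z' by apply: e_down => //; apply: (allP all2); rewrite inE eqxx.
have [|zO bz] := e_parents ep ez.
  by apply: contraTneq lin => ->; apply: dis; rewrite !inE eqxx orbT.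
(* Seen from z, v is on the side of one parent, while x and y are both on the side of the other; yet
   v lies between x and y. *)
have s1 := same_side_plus zO pp1 all1.
have s2 := same_side_plus zO pp2 all2; rewrite lp in s2.
have pp3 : path a z' (rcons p2 y) by rewrite rcons_path pp2 lp.
have := same_side_plus zO pp3 all3; rewrite last_rcons => s3.
have n1 := lt_k_neq h1; have n2 := lt_k_neq (ltn_trans h1 vx).
have n3 := lt_k_neq (ltn_trans h1 vy).
by move: s1 s2 s3 n1 n2 n3 bz bxy; rewrite /between; clear; lia.
Qed.

End TreeDrawing.

(** * The permutree of a permutation *)

(* Read s from left to right. Just after u has been read, a vertical wall     *)
(* stands at each plus node already read and at each minus node still to be   *)
(* read; u is then joined to the next node it can see, on each of its sides   *)
(* if u is itself a plus node.                                                *)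
Section PermutreeOfPermutation.
Variables (n : nat) (o : orientation n) (s : 'S_n).
Implicit Types u v w x b : 'I_n.

Let k u : nat := pos s u.

Definition wall u b : bool :=
  ((b \in Oplus o) && (k b <= k u)) || ((b \in Ominus o) && (k u < k b)).

Definition sees u w : bool :=
  (k u < k w) && [forall b : 'I_n, between u b w ==> ~~ wall u b].

(** With O the plus nodes this compares parents of u, with O the minus nodes its children. *)
Definition same_slot (O : {set 'I_n}) u w x : bool := (u \notin O) || ~~ between w u x.

Definition next u w : bool :=
  sees u w && [forall x, sees u x && same_slot (Oplus o) u w x ==> (k w <= k x)].

Let k_inj : injective k.
Proof. by move=> u v /val_inj /pos_inj. Qed.

Let neq_of_lt u v : k u < k v -> u != v :> nat.
Proof. by apply: contraTneq => /val_inj ->; rewrite ltnn. Qed.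

Let k_neq u v : u != v :> nat -> k u != k v.
Proof. by apply: contraNneq => /k_inj ->. Qed.

Let seesP u w : reflect (k u < k w /\ forall b : 'I_n, between u b w -> ~~ wall u b) (sees u w).
Proof.
apply: (iffP andP) => [] [h1 h2]; split=> //.
  by move=> b; move/forallP: h2 => /(_ b) /implyP.
by apply/forallP=> b; apply/implyP; exact: h2.
Qed.

Let nextP u w : reflect
  (sees u w /\ forall x, sees u x -> same_slot (Oplus o) u w x -> k w <= k x) (next u w).
Proof.
apply: (iffP andP) => [] [h1 h2]; split=> //.
  by move=> x h3 h4; move/forallP: h2 => /(_ x) /implyP; apply; rewrite h3.
by apply/forallP=> b; apply/implyP=> /andP [] ; exact: h2.
Qed.

Let sees_between u b w : sees u w -> between u b w -> k u < k b -> sees u b.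
Proof.
move=> /seesP [_ h] bt kb; apply/seesP; split=> // b' bt'; apply: h.
by move: bt bt'; rewrite /between; clear; lia.
Qed.

Lemma sees_or_wall u w : k u < k w ->
  sees u w \/ exists b, [/\ between u b w, wall u b & (k u < k b -> sees u b)].
Proof.
move=> uw; case suw : (sees u w); [by left | right].
have [b0 P0] : exists b, between u b w && wall u b.
  apply/existsP; apply: contraFT suw; rewrite negb_exists => /forallP h.
  by apply/seesP; split=> // b bt; have := h b; rewrite bt.
(* The two truncated differences add up to the distance from b to u, so b is the wall nearest to u
   and no other wall hides it. *)
case: (@arg_minnP _ b0 (fun b : 'I_n => between u b w && wall u b)
  (fun b : 'I_n => (b - u) + (u - b)) P0) => b /andP [bt wb] bmin.
exists b; split=> // kb; apply/seesP; split=> // b' bt'; apply/negP=> wb'.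
have bt2 : between u b' w by move: bt bt'; rewrite /between; clear; lia.
have := bmin b'; rewrite bt2 wb' => /(_ isT).
by move: bt'; rewrite /between; clear; lia.
Qed.

Lemma next_lt u w : next u w -> k u < k w.
Proof. by case/nextP => /seesP []. Qed.

(** Since b is no wall at u, it is read after u; then u sees b in the slot of w, and w is the first
    such node. *)
Lemma next_plus u w b : next u w -> between u b w -> b \in Oplus o -> k w < k b.
Proof.
move=> /nextP [suw h] bt bO; have /seesP [_ /(_ _ bt)] := suw.
rewrite /wall bO /= negb_or -ltnNge => /andP [ub _].
have wb : k w != k b by apply: k_neq; move: bt; rewrite /between; clear; lia.
rewrite ltn_neqAle wb; apply: h; first exact: sees_between suw bt ub.
by apply/orP; right; move: bt; rewrite /between; clear; lia.
Qed.

Lemma next_minus u w b : next u w -> between u b w -> b \in Ominus o -> k b < k u.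
Proof.
move=> /nextP [/seesP [_ h] _] bt bO; have := h _ bt.
rewrite /wall bO /= negb_or -leqNgt => /andP [_ bu].
by rewrite ltn_neqAle bu andbT; apply: k_neq; move: bt; rewrite /between; clear; lia.
Qed.

Lemma next_parent_inj u p p' : next u p -> next u p' -> same_slot (Oplus o) u p p' -> p = p'.
Proof.
move=> /nextP [s1 h1] /nextP [s2 h2] sl; apply: k_inj; apply/eqP.
rewrite eqn_leq h1 // h2 //; move: sl; rewrite /same_slot /between; clear; lia.
Qed.

Lemma next_child_inj w u x : next u w -> next x w -> same_slot (Ominus o) w u x -> u = x.
Proof.
suff main (y z : 'I_n) :
    next y w -> next z w -> same_slot (Ominus o) w y z -> ~~ (k y < k z).
  move=> h1 h2 sl; apply: k_inj; apply/eqP; rewrite eqn_leq.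
  apply/andP; split; rewrite leqNgt main //.
  by move: sl; rewrite /same_slot /between; clear; lia.
move=> {u x} nu nx sl; apply/negP=> ux; move: y z nu nx sl ux => u x nu nx sl ux.
have [suw first] := nextP _ _ nu; have uw := next_lt nu; have xw := next_lt nx.
have nuw := neq_of_lt uw; have nxw := neq_of_lt xw; have nux := neq_of_lt ux.
have uO : between x u w -> u \notin Oplus o.
  by move=> bt; apply/negP=> /(next_plus nx bt); rewrite ltnNge (ltnW uw).
have blocked z : sees u z -> k z < k w -> between x u w || ~~ between w u z -> False.
  move=> uz zw sd; have := first z uz; rewrite leqNgt zw => h.
  by have := h _; rewrite /same_slot; case/orP: sd => [/uO -> | ->];
    rewrite ?orbT => /(_ isT).
case: (sees_or_wall ux) => [sux|[b [bt wb sb]]].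
  by apply: (blocked x) => //; rewrite /between; clear; lia.
have bN : ~~ between u b w by apply/negP => /(seesP _ _ suw).2; rewrite wb.
have bw : b != w :> nat.
  apply/negP=> /eqP /val_inj bE; rewrite bE in bt wb; move: sl wb.
  by rewrite /same_slot bt orbF /wall => /negbTE ->; rewrite leqNgt uw andbF.
have bxw : between x b w by move: bt bN bw nux nuw nxw; rewrite /between; clear; lia.
(* A plus wall is read by the time of u, but the edge from x to w crosses b, which would put b after
   w; so b is a minus node. *)
have [kub kbx] : k u < k b /\ k b < k x.
  case/orP: wb => /andP [bO kb]; last by split=> //; exact: next_minus nx bxw bO.
  by have := next_plus nx bxw bO; rewrite ltnNge (leq_trans kb (ltnW uw)).
apply: (blocked b); [exact: sb | exact: ltn_trans kbx xw |].
by move: bt nuw; rewrite /between; clear; lia.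
Qed.

(** The first node x that u sees in the slot of w still sees w: a wall that appeared since u would
    be a plus node seen by u before x. Recursion on the remaining reading time finishes. *)
Lemma sees_connect u w : sees u w -> connect next u w.
Proof.
have [m] := ubnP (k w - k u); elim: m u => // m IH u km suw.
have P0 : sees u w && same_slot (Oplus o) u w w.
  by rewrite suw /same_slot /between; apply/orP; right; clear; lia.
case: (@arg_minnP _ w (fun x => sees u x && same_slot (Oplus o) u w x) k P0) =>
  x /andP [sux slx] xmin.
have [uw wuw] := seesP _ _ suw; have [ux wux] := seesP _ _ sux.
have nuw := neq_of_lt uw; have nux := neq_of_lt ux.
have nx : next u x.
  apply/nextP; split=> // y suy sly; apply: xmin; rewrite suy.
  have [uy _] := seesP _ _ suy; have nuy := neq_of_lt uy.
  move: slx sly nuw nux nuy; rewrite /same_slot /between; case: (u \in Oplus o) => //=.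
  by clear; lia.
have xw : k x <= k w by apply: xmin.
case: (eqVneq x w) => [<-|xNw]; first exact: connect1.
have {}xw : k x < k w by rewrite ltn_neqAle xw andbT (inj_eq k_inj).
apply: connect_trans (connect1 nx) _; apply: IH; first by move: km xw ux uw; clear; lia.
apply/seesP; split=> // b bt; apply/negP=> wb.
have bx : b != x by rewrite -val_eqE /=; move: bt; rewrite /between; clear; lia.
have [bu|bu] := eqVneq b u.
  rewrite bu in bt wb; move: slx; rewrite /same_slot => /orP [/negbTE uO|].
    by move: wb; rewrite /wall uO /= ltnNge (ltnW ux) andbF.
  by move: bt; rewrite /between; clear; lia.
have [y suy buy] : exists2 y, sees u y & between u b y.
  case bux : (between u b x); first by exists x.
  by exists w => //; move: bt bux bu nux nuw; rewrite -val_eqE /= /between; clear; lia.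
have := (seesP _ _ suy).2 _ buy; rewrite /wall negb_or => /andP [w1 w2].
case/orP: wb => /andP [bO kb].
  rewrite bO /= -ltnNge in w1; have sub := sees_between suy buy w1.
  have := xmin b; rewrite sub andTb => h.
  have xb : k x <= k b.
    apply: h; move: slx bt bu nux nuw; rewrite -val_eqE /= /same_slot /between.
    by case: (u \in Oplus o) => //=; clear; lia.
  by case/negP: bx; apply/eqP/k_inj/eqP; rewrite eqn_leq kb xb.
by move/negP: w2; apply; rewrite bO (ltn_trans ux kb).
Qed.

Lemma next_adj_connect u w : connect (fun x y => next x y || next y x) u w.
Proof.
set e := fun x y => _; have esym : connect_sym e.
  by apply: sym_connect_sym => x y; rewrite /e orbC.
have seesC x y : sees x y -> connect e x y.
  by move/sees_connect; apply: connect_sub => a b ab; apply: connect1; rewrite /e ab.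
(* No label lies between consecutive ones, so the one read earlier sees the other. *)
have consec (x y : 'I_n) : y = x.+1 :> nat -> connect e x y.
  move=> xy; have nb (b : 'I_n) : ~~ between x b y && ~~ between y b x.
    by rewrite xy /between; clear; lia.
  case: (ltngtP (k x) (k y)) => [h|h|/k_inj -> //].
    by apply/seesC/seesP; split=> // b bt; have := nb b; rewrite bt.
  rewrite esym; apply/seesC/seesP; split=> // b bt; have := nb b; rewrite bt andbF //.
have up m (x y : 'I_n) : y = x + m :> nat -> connect e x y.
  elim: m y => [|m IH] y xy.
    by have -> : y = x by apply: val_inj; rewrite /= xy addn0.
  have lt : x + m < n by have := ltn_ord y; rewrite xy; clear; lia.
  apply: (connect_trans (IH (Ordinal lt) erefl)); apply: consec => /=.
  by rewrite xy addnS.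
case: (leqP u w) => uw; first by apply: (up (w - u)); rewrite subnKC.
by rewrite esym; apply: (up (u - w)); rewrite subnKC // ltnW.
Qed.

Definition slot_side (t : slot) u w : bool :=
  match t with Left => w < u | Mid => true | Right => u < w end.

Definition permutree_of : slotted_graph n := SlottedGraph
  (fun u t => if has_slot (u \in Oplus o) t
              then [pick w | next u w && slot_side t u w] else None)
  (fun w t => if has_slot (w \in Ominus o) t
              then [pick u | next u w && slot_side t w u] else None).

Let slot_side_same (O : {set 'I_n}) u w x t : has_slot (u \in O) t ->
  slot_side t u w -> slot_side t u x -> same_slot O u w x.
Proof.
rewrite /same_slot /between; case: t => /=; [| by move=> -> |];
by move=> _ h1 h2; apply/orP; right; move: h1 h2; clear; lia.
Qed.

Lemma parent_permutree_of u t w : parent permutree_of u t = Some w <->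
  [/\ has_slot (u \in Oplus o) t, next u w & slot_side t u w].
Proof.
rewrite /=; split.
  by case: ifP => // ht; case: pickP => // x /andP [h1 h2] [<-].
case=> ht nw sw; rewrite ht; case: pickP => [x /andP [nx sx]|/(_ w)]; last by rewrite nw sw.
by rewrite (next_parent_inj nx nw) // (slot_side_same ht).
Qed.

Lemma child_permutree_of w t u : child permutree_of w t = Some u <->
  [/\ has_slot (w \in Ominus o) t, next u w & slot_side t w u].
Proof.
rewrite /=; split.
  by case: ifP => // ht; case: pickP => // x /andP [h1 h2] [<-].
case=> ht nw sw; rewrite ht; case: pickP => [x /andP [nx sx]|/(_ u)]; last by rewrite nw sw.
by rewrite (next_child_inj nx nw) // (slot_side_same ht).
Qed.

Let slot_exists (O : {set 'I_n}) u w : u != w :> nat ->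
  exists t, has_slot (u \in O) t /\ slot_side t u w.
Proof.
case uO : (u \in O) => uw; last by exists Mid.
by case: (ltngtP u w) uw => // h _; [exists Right | exists Left].
Qed.

Lemma edge_permutree_of u w : edge permutree_of u w = next u w.
Proof.
apply/edgeP/idP => [[t /parent_permutree_of []] //|nw].
have [t [h1 h2]] := slot_exists (Oplus o) (neq_of_lt (next_lt nw)).
by exists t; apply/parent_permutree_of.
Qed.

Lemma child_edge_permutree_of u w :
  (exists t, child permutree_of w t = Some u) <-> next u w.
Proof.
split=> [[t /child_permutree_of []] //|nw].
have nwu : w != u :> nat by rewrite eq_sym; exact: neq_of_lt (next_lt nw).
have [t [h1 h2]] := slot_exists (Ominus o) nwu.
by exists t; apply/child_permutree_of.
Qed.

Let between_of_slot (O : {set 'I_n}) u w x : ~~ same_slot O u w x -> u \in O /\ between w u x.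
Proof. by rewrite /same_slot negb_or !negbK => /andP []. Qed.

Let parents u p p' : next u p -> next u p' -> p != p' -> u \in Oplus o /\ between p u p'.
Proof.
move=> h1 h2 pp'; apply: between_of_slot; apply: contraNN pp' => h.
by apply/eqP; exact: next_parent_inj h.
Qed.

Let children w u u' : next u w -> next u' w -> u != u' -> w \in Ominus o /\ between u w u'.
Proof.
move=> h1 h2 pp'; apply: between_of_slot; apply: contraNN pp' => h.
by apply/eqP; exact: next_child_inj h.
Qed.

Lemma permutree_of_permutree : is_permutree o permutree_of.
Proof.
have aE : adj permutree_of =2 (fun x y => next x y || next y x).
  by move=> x y; rewrite /adj !edge_permutree_of.
split.
- split.
  + move=> u v; rewrite !edge_permutree_of => /next_lt uv.
    by apply/negP=> /next_lt; rewrite ltnNge (ltnW uv).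
  + by move=> u v; rewrite (eq_connect aE); exact: next_adj_connect.
  + move=> c; rewrite /ucycle /ucycleb (eq_cycle aE).
    exact: (drawing_acyclic k_inj next_lt next_minus children).
- move=> u v; rewrite child_edge_permutree_of -edge_permutree_of.
  by split=> /edgeP.
- have slot_inj (O : {set 'I_n}) v w t t' : has_slot (v \in O) t -> slot_side t v w ->
      has_slot (v \in O) t' -> slot_side t' v w -> t = t'.
    by case: t; case: t' => //=; case: (v \in O) => //= _ h1 _ h2; move: h1 h2; clear; lia.
  move=> v t t' w; split.
    by move=> /parent_permutree_of [h1 _ h2] /parent_permutree_of [h3 _ h4];
      exact: slot_inj h1 h2 h3 h4.
  by move=> /child_permutree_of [h1 _ h2] /child_permutree_of [h3 _ h4];
    exact: slot_inj h1 h2 h3 h4.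
- by move=> v t; split=> /= /negbTE ->.
- move=> v w u; rewrite /in_subtree.
  have -> : connect (fun x y => [&& adj permutree_of x y, x != v & y != v]) w u =
      connect (fun x y => [&& next x y || next y x, x != v & y != v]) w u.
    by apply: eq_connect => x y; rewrite aE.
  move=> c.
  have down : v \in Ominus o -> next w v -> ~~ between w v u /\ u != v.
    move=> vO nw; apply: (drawing_child_side k_inj next_lt next_plus next_minus parents vO nw c).
  have up : v \in Oplus o -> next v w -> ~~ between w v u /\ u != v.
    (* The side of a parent is the side of a child in the drawing turned upside down; [k x < n]
       makes the truncated subtraction strictly decreasing. *)
    move=> vO nw; pose k' x := n - k x.
    have kn x : k x < n by exact: ltn_ord.
    have rev x y : k x < k y -> k' y < k' x.
      by have := kn x; have := kn y; rewrite /k'; clear; lia.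
    have bs (x b y : nat) : between x b y -> between y b x by rewrite /between orbC.
    apply: (@drawing_child_side n (fun x y => next y x) k' (Ominus o) (Oplus o)) vO nw _.
    + move=> x y h; apply: k_inj; move: h; have := kn x; have := kn y; rewrite /k'.
      by clear; lia.
    + by move=> x y /next_lt; exact: rev.
    + by move=> x y b h /bs bt bO; apply: rev; exact: next_minus h bt bO.
    + by move=> x y b h /bs bt bO; apply: rev; exact: next_plus h bt bO.
    + by move=> x y y'; exact: children.
    + have -> : connect (fun x y => [&& next y x || next x y, x != v & y != v]) w u =
        connect (fun x y => [&& next x y || next y x, x != v & y != v]) w u.
        by apply: eq_connect => x y; rewrite orbC.
      exact: c.
  split=> vO.
  + move=> /parent_permutree_of [_ nw /= sd]; have [h1 h2] := up vO nw.
    by move: h1 h2 sd; rewrite -val_eqE /= /between; clear; lia.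
  + move=> /parent_permutree_of [_ nw /= sd]; have [h1 h2] := up vO nw.
    by move: h1 h2 sd; rewrite -val_eqE /= /between; clear; lia.
  + move=> /child_permutree_of [_ nw /= sd]; have [h1 h2] := down vO nw.
    by move: h1 h2 sd; rewrite -val_eqE /= /between; clear; lia.
  + move=> /child_permutree_of [_ nw /= sd]; have [h1 h2] := down vO nw.
    by move: h1 h2 sd; rewrite -val_eqE /= /between; clear; lia.
Qed.

Lemma in_tree_rel_permutree_of u w :
  ((u, w) \in tree_rel permutree_of) = connect next u w.
Proof.
by rewrite in_tree_rel; apply: eq_connect => x y; exact: edge_permutree_of.
Qed.

Lemma permutree_of_linear_extension : linear_extension (tree_rel permutree_of) s.
Proof.
apply/linear_extensionP=> u w; rewrite in_tree_rel_permutree_of.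
move: w; apply: connect_ind_right => // x w _ /next_lt xw h.
exact: leq_trans h (ltnW xw).
Qed.

(** If u R w but u does not see w, take the nearest wall b between them. A plus wall is impossible,
    as u R b puts b after u; so b is a minus node seen by u, and b R w is a pair with closer
    labels. *)
Lemma sub_tree_rel_permutree_of (R : brel n) : inc_closed o R -> dec_closed o R ->
  linear_extension R s -> R \subset tree_rel permutree_of.
Proof.
move=> ci cd /linear_extensionP le; apply/subsetP=> [[u w]].
rewrite in_tree_rel_permutree_of.
have [m] := ubnP ((u - w) + (w - u)); elim: m u => // m IH u um uwR.
have [-> //|uw] := eqVneq u w.
have kuw : k u < k w by rewrite /k pos_lt uw le.
case: (sees_or_wall kuw) => [/sees_connect //|[b [bt wb sb]]].
have bu : b != u by rewrite -val_eqE /=; move: bt; rewrite /between; clear; lia.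
have [cp cm] : (b \in Oplus o -> (u, b) \in R) /\ (b \in Ominus o -> (b, w) \in R).
  by case/orP: (bt) => /andP [h1 h2]; [exact: ci h1 h2 uwR | exact: cd h1 h2 uwR].
case/orP: wb => /andP [bO kb].
  by move: kb; rewrite leqNgt /k pos_lt eq_sym bu le // cp.
apply: connect_trans (sees_connect (sb kb)) (IH _ _ (cm bO)).
by move: um bt; rewrite /between; clear; lia.
Qed.

End PermutreeOfPermutation.

(** * Characterization of PIP and conclusion *)

Section Conclusion.
Variables (n : nat) (o : orientation n).
Hypothesis co : covering o.

(** The trees are those of the minimal extension [s] and the maximal extension [s']. A common pair
    is in order in both, and [s'] detects membership in R of increasing pairs, [s] that of
    decreasing ones. *)
Lemma inc_dec_poset_PIP (R : brel n) : inc_poset o R -> dec_poset o R -> PIP o R.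
Proof.
move=> iR dR; have [[pR ci] [_ cd]] := (iR, dR).
have [s ms] := min_linear_extension_exists co dR.
have [s' ms'] := max_linear_extension_exists co iR.
have ls := ms.1; have ls' := ms'.1; have ts := permutree_of_linear_extension o s.
have ts' := permutree_of_linear_extension o s'.
exists (permutree_of o s), (permutree_of o s'); split.
- exact: permutree_of_permutree.
- exact: permutree_of_permutree.
- by exists s, s'; split=> //; exact: ms.2.
- apply/eqP; rewrite eqEsubset; apply/andP; split.
    by rewrite subsetI !sub_tree_rel_permutree_of.
  apply/subsetP=> [[u v]]; rewrite inE => /andP [h h'].
  move/linear_extensionP: ts => /(_ _ _ h) {}h.
  move/linear_extensionP: ts' => /(_ _ _ h') {}h'.
  case: (ltngtP u v) => [uv|uv|/val_inj ->]; last by case: pR.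
    by rewrite (max_linear_extension_inc pR ms' uv) pos_lt h' -val_eqE /= neq_ltn uv.
  by rewrite (min_linear_extension_dec pR ms uv) pos_lt h -val_eqE /= neq_ltn uv orbT.
Qed.

Lemma PIP_iff (R : brel n) : PIP o R <-> inc_poset o R /\ dec_poset o R.
Proof.
by split=> [|[]]; [exact: PIP_inc_dec_poset | exact: inc_dec_poset_PIP].
Qed.

End Conclusion.

Lemma sublattice_iff n (F G : brel n -> Prop) : (forall R, F R <-> G R) ->
  induces_sublattice G -> induces_sublattice F.
Proof.
move=> FG [h1 h2]; split=> [R /FG /h1 //|R S /FG hR /FG hS].
by have [? ?] := h2 _ _ hR hS; split; apply/FG.
Qed.

Theorem theorem84 (n : nat) (o : orientation n) (ho : covering o) :
  [/\ induces_sublattice (IPIP o),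
      induces_sublattice (DPIP o)
    & induces_sublattice (PIP o)].
Proof.
have [i1 i2] := inc_poset_sublattice ho; have [d1 d2] := dec_poset_sublattice ho.
split.
- by apply: sublattice_iff (inc_poset_sublattice ho) => R; exact: IPIP_inc_poset.
- by apply: sublattice_iff (dec_poset_sublattice ho) => R; exact: DPIP_dec_poset.
- apply: sublattice_iff (fun R => PIP_iff ho R) _.
  split=> [R [/i1 //]|R S [iR dR] [iS dS]].
  by have [? ?] := i2 _ _ iR iS; have [? ?] := d2 _ _ dR dS.
Qed.
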